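(* Let $G$ be an infinite group of cardinality $\varkappa$, and let $\lambda$ be an infinite cardinal with $\lambda\le\varkappa$. Then $G$ can be partitioned into $\varkappa$ $\lambda$-thick subsets provided that either $\lambda=\varkappa$ and $\varkappa$ is regular, or $\lambda<\varkappa$.
   Context: For a cardinal $\lambda\le|G|$, a subset $A$ of a group $G$ is called left $\lambda$-thick (respectively right $\lambda$-thick) if for every subset $F\subseteq G$ with $|F|<\lambda$ there exists $a\in A$ such that $Fa\subseteq A$ (respectively $aF\subseteq A$). The subset $A$ is called $\lambda$-thick if it is both left and right $\lambda$-thick. *)

(* Defs.v *)
From mathcomp Require Import all_boot.
From mathcomp Require Import boolp classical_sets functions cardinality.

Set Implicit Arguments.
Unset Strict Implicit.
Unset Printing Implicit Defensive.

Local Open Scope classical_set_scope.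
Local Open Scope card_scope.

(* A cardinal is represented by an arbitrary set having that cardinality. *)
Definition card_lt T U (A : set T) (B : set U) : Prop :=
  A #<= B /\ ~ (B #<= A).

Notation "A '#<' B" := (card_lt A B)
  (at level 79, format "A  '#<'  B") : card_scope.

(* The index set I may be taken inside T without loss of generality, since
   only index sets with fewer than |K| elements matter. *)
Definition regular_cardinal T (K : set T) : Prop :=
  infinite_set K /\
  forall (I : set T) (F : T -> set T),
    I #< K -> (forall i, I i -> F i #< K) -> \bigcup_(i in I) F i #< K.

(* MathComp's [groupType] does not require finiteness. *)
Definition left_thick (G : groupType) U (L : set U) (A : set G) : Prop :=
  forall F : set G, F #< L ->
    exists2 a, A a & [set (x * a)%g | x in F] `<=` A.

Definition right_thick (G : groupType) U (L : set U) (A : set G) : Prop :=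
  forall F : set G, F #< L ->
    exists2 a, A a & [set (a * x)%g | x in F] `<=` A.

Definition thick (G : groupType) U (L : set U) (A : set G) : Prop :=
  left_thick L A /\ right_thick L A.

(* Main.v *)
Require Import Defs.
From mathcomp Require Import all_boot.
From mathcomp Require Import boolp classical_sets functions cardinality.
From mathcomp Require wochoice.

(** Let kappa be the cardinal of [G] and lambda that of [L]. It suffices to find
    kappa pairwise disjoint thick sets, because a superset of a thick set is
    thick ([partition_of_family]). Fix a well-order of [G] all of whose segments
    have fewer than kappa elements.

    The easy case is when every subset of [G] smaller than kappa is bounded, that
    is, when kappa is regular; this includes the case where kappa is the
    successor of lambda. Choose by transfinite recursion elements [a w] such
    that the sets formed by [a w * seg w] and [seg w * a w] are disjoint for
    different [w], and distribute them among kappa colours so that each colour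
    occurs unboundedly often ([bounded_family]).

    Otherwise the successor nu of lambda is smaller than kappa. A set [F] of
    size at most lambda may now be cofinal in [G], and two ideas are needed. Both use a
    tower of subgroups [M w] in which [a w] is a new element at stage [w].

    The first idea gives kappa disjoint sets that are thick on one side
    ([one_sided_family]). Attach nu indices to each colour [d]. For each [y], let
    the request [(y, d)] ask for colour [d] on the elements [a b * y], for these
    indices [b]. The least element of [M b * z] decreases as [b] grows, so it
    changes only finitely often; and passing from [y] to [z = a b * y] creates,
    with finitely many exceptions, such a change at [b]. Hence each [z] is
    claimed by finitely many requests, and the components of the graph of
    competing requests have at most nu vertices. Number each component by nu and
    serve requests in that order. Two requests of different colours compete for
    at most one element, so each request is refused at most lambda times.

    Left and right requests cannot be served together in this way, since a
    left translate of one sequence of nu elements may coincide with a right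
    translate of another. The second idea is to use different cardinals for
    the two sides and to separate the search for a colour from the passage to
    two sides ([two_sided_family]). Left encoding replaces [x] by [x * a c] with
    [c] among the first nu elements; right encoding replaces [y] by [a b * y]
    with [b] among the first nu+ elements, nu+ being the successor of nu, which
    is at most kappa. In both cases the encoded element determines [x] or [y].
    The elements produced by right encoding are so sparse, at most lambda in
    each left coset of a subgroup of size nu, that left encoding can avoid them.
    Colouring an encoded element by the one-sided colour of what it encodes
    (inverted, for left encoding) gives sets that are thick on both sides. *)

Set Implicit Arguments.
Unset Strict Implicit.
Unset Printing Implicit Defensive.

Local Open Scope classical_set_scope.
Local Open Scope card_scope.

(** * Injections and cardinal comparison *)

Lemma card_le_fun {T U} (f : T -> U) (A : set T) (B : set U) :
    (forall x, A x -> B (f x)) ->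
    (forall x y, A x -> A y -> f x = f y -> x = y) ->
  A #<= B.
Proof.
move=> fAB finj; apply/inj_card_le/unsquash.
apply/injfunPex; exists f => // x y; rewrite !inE; exact: finj.
Qed.

(** Most injections below are only described by a relation, because the natural
    image of an element involves a chosen witness. *)
Lemma card_le_rel {T U} (R : T -> U -> Prop) (A : set T) (B : set U) :
    (forall x, A x -> exists2 y, B y & R x y) ->
    (forall x x' y, A x -> A x' -> B y -> R x y -> R x' y -> x = x') ->
  A #<= B.
Proof.
move=> AB Rinj; have [->|/set0P[x0 Ax0]] := eqVneq A set0; first exact: card_ge0.
have [y0 _ _] := AB _ Ax0.
have /choice[f fP] x : exists y, A x -> B y /\ R x y.
  have [Ax|nAx] := pselect (A x); last by exists y0.
  by have [y By Rxy] := AB _ Ax; exists y.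
apply: (@card_le_fun _ _ f) => [x /fP[]//|x y Ax Ay fxy].
have [Bx Rx] := fP _ Ax; have [By Ry] := fP _ Ay.
by apply: (Rinj x y (f x)) => //; rewrite fxy.
Qed.

Lemma card_le_funP {T U} (A : set T) (B : set U) : A #<= B -> A !=set0 ->
  exists2 f : T -> U, (forall x, A x -> B (f x)) &
    (forall x y, A x -> A y -> f x = f y -> x = y).
Proof.
move=> AB [x Ax].
elim/Ppointed: U => U in B AB *.
  by move: AB; rewrite card_le_emptyr => /eqP A0; rewrite A0 in Ax.
have /pcard_leP/injfunPex[f fAB finj] := AB.
by exists f => // u v Au Av; apply: finj; rewrite inE.
Qed.

Lemma card_leX {T U V W} (A : set T) (B : set U) (A' : set V) (B' : set W) :
  A #<= A' -> B #<= B' -> A `*` B #<= A' `*` B'.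
Proof.
move=> AA BB; have [->|/set0P[[x y] [/= Ax By]]] := eqVneq (A `*` B) set0.
  exact: card_ge0.
have [|f fA fi] := card_le_funP AA; first by exists x.
have [|g gB gi] := card_le_funP BB; first by exists y.
apply: (@card_le_fun _ _ (fun p => (f p.1, g p.2))) => [[u v] [/= ? ?]|].
  by split => /=; [exact: fA|exact: gB].
move=> [u v] [u' v'] [/= ? ?] [/= ? ?] [/fi-> // /gi->//].
Qed.

Lemma finite_le_infinite {T U} (A : set T) (B : set U) :
  finite_set A -> infinite_set B -> A #<= B.
Proof. by move=> /finite_set_countable cA /infiniteP; apply: card_le_trans. Qed.

Lemma infinite_le {T U} (A : set T) (B : set U) :
  A #<= B -> infinite_set A -> infinite_set B.
Proof. by move=> AB; apply: contra_not; exact: card_le_finite. Qed.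

(** * Well-orders and transfinite choice *)

Definition seg {T} (lt : T -> T -> Prop) (w : T) : set T := [set v | lt v w].

Definition strict_wo {T} (lt : T -> T -> Prop) : Prop :=
  [/\ well_founded lt, (forall x y z, lt x y -> lt y z -> lt x z) &
      forall x y, [\/ lt x y, x = y | lt y x]].

Lemma strict_wo_exists (T : Type) : exists lt : T -> T -> Prop, strict_wo lt.
Proof.
elim/Peq: T => T; have [R woR] := wochoice.well_ordering_principle T.
have minP (A : set T) : A !=set0 ->
    exists z, [/\ A z, forall x, A x -> R z x &
      forall z', A z' -> (forall x, A x -> R z' x) -> z = z'].
  move=> [x Ax]; have [|z [[zA zmin] zuniq]] := woR (mem A).
    by exists x; rewrite inE.
  exists z; split=> [|y Ay|y Ay ymin].
  - by move: zA; rewrite inE.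
  - by apply: zmin; rewrite inE.
  - by apply: zuniq; split=> [|u]; rewrite inE//; exact: ymin.
have refl x : R x x by have [|z [-> zx _]] := minP [set x]; [exists x|exact: zx].
have anti x y : R x y -> R y x -> x = y.
  move=> xy yx; have [|z [_ _ zu]] := minP [set x; y]; first by exists x; left.
  have <- := zu x (or_introl erefl); last by move=> _ [->|->].
  by apply: zu => [|_ [->|->]]; [right|..].
pose lt x y := R x y /\ x <> y; exists lt.
have tot x y : [\/ lt x y, x = y | lt y x].
  have [->|/eqP xy] := eqVneq x y; first exact: Or32.
  have [|z [[->|->] zm _]] := minP [set x; y]; first by exists x; left.
    by apply: Or31; split=> //; apply: zm; right.
  by apply: Or33; split; [apply: zm; left|exact/nesym].
split; last exact: tot.
- move=> x; apply: contrapT => nx.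
  have [|z [nz zm _]] := minP [set x | ~ Acc lt x]; first by exists x.
  apply: nz; constructor => y [Ryz yz]; apply: contrapT => /zm Rzy.
  by apply: yz; exact: anti.
- move=> x y z [Rxy xy] [Ryz yz].
  have [|t [tS tm _]] := minP [set x; y; z]; first by exists x; left; left.
  have xz : x <> z.
    by move=> xz; apply: xy; apply: anti; rewrite // xz.
  split=> //; case: tS => [[|]|] /= tE; move: tm; rewrite {}tE => tm.
  + by apply: tm; right.
  + by case: xy; apply: anti => //; apply: tm; left; left.
  + by case: yz; apply: anti => //; apply: tm; left; right.
Qed.

Section StrictWo.
Context {T : Type} {lt : T -> T -> Prop} (lt_wo : strict_wo lt).

Lemma wo_irr x : ~ lt x x.
Proof.
case: lt_wo => wf _ _; elim/(well_founded_ind wf): x => x IH xltx.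
exact: (IH x).
Qed.

Lemma wo_asym x y : lt x y -> ~ lt y x.
Proof. by case: lt_wo => _ tr _ xy /(tr _ _ _ xy); exact: wo_irr. Qed.

Lemma wo_min (A : set T) : A !=set0 ->
  exists2 z, A z & forall x, A x -> ~ lt x z.
Proof.
case: lt_wo => wf _ _ [x]; elim/(well_founded_ind wf): x => x IH Ax.
have [[y Ay yx]|nex] := pselect (exists2 y, A y & lt y x); first exact: IH Ay.
by exists x => // y Ay yx; apply: nex; exists y.
Qed.

End StrictWo.

(** Transfinite recursion in the form used throughout: [Phi q S] is what is
    forbidden at stage [q] when [S] is the set of earlier choices, and such an
    [S] has at most as many elements as there are earlier stages. *)
Lemma greedy {Q T} (lt : Q -> Q -> Prop) (Phi : Q -> set T -> set T) :
    well_founded lt ->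
    (forall q S, S #<= seg lt q -> exists t, ~ Phi q S t) ->
  exists a : Q -> T, forall q, ~ Phi q (a @` seg lt q) (a q).
Proof.
move=> wf ex.
have [[q0 _]|noQ] := pselect (exists q : Q, True); last first.
  by exists (fun q => False_rect T (noQ (ex_intro _ q I))) => q; case: noQ; exists q.
have [t0 _] := ex q0 set0 (card_ge0 _ _).
have /choice[c cP] (p : Q * set T) :
    exists t, p.2 #<= seg lt p.1 -> ~ Phi p.1 p.2 t.
  have [/ex[t]|] := pselect (p.2 #<= seg lt p.1); first by exists t.
  by exists t0.
pose step q (rec : forall v, lt v q -> T) :=
  c (q, [set s | exists v (h : lt v q), rec v h = s]).
pose a := Fix wf (fun _ => T) step.
have aE q : a q = c (q, a @` seg lt q).
  rewrite /a Fix_eq -/a; last first.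
    move=> x f g fg; congr (c (x, _)); apply/seteqP.
    by split=> s [v [h <-]]; exists v, h; rewrite fg.
  congr (c (q, _)); apply/seteqP; split=> s.
    by move=> [v [h <-]]; exists v.
  by move=> [v h <-]; exists v, h.
by exists a => q; rewrite aE; apply: cP (q, _) _; exact: card_image_le.
Qed.

(** A well-ordered set whose initial segments are all too small to contain a
    copy of [I] injects into [I]: send each element to a point of [I] that has
    not been used before. This replaces the comparison of ordinals. *)
Lemma greedy_card_le {Q T} (lt : Q -> Q -> Prop) (D : set Q) (I : set T) :
    strict_wo lt -> (forall p q, lt p q -> D q -> D p) ->
    (forall q, D q -> ~ (I #<= seg lt q)) ->
  D #<= I.
Proof.
move=> wo Ddown small; have [->|/set0P[q0 Dq0]] := eqVneq D set0.
  exact: card_ge0.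
have [t0 It0] : I !=set0.
  by apply/set0P/eqP => I0; apply: (small _ Dq0); rewrite I0; exact: card_ge0.
have [wf _ tot] := wo.
have [q S Sq|a aP] := @greedy Q T lt (fun q S t => D q /\ (I t -> S t)) wf.
  have [Dq|nDq] := pselect (D q); last by exists t0 => -[].
  apply: contrapT => nex; apply: (small q Dq); apply: card_le_trans Sq.
  apply: subset_card_le => t It; apply: contrapT => nSt; apply: nex.
  by exists t => -[_ /(_ It)].
have fresh q : D q -> I (a q) /\ ~ (a @` seg lt q) (a q).
  move=> Dq; split; first by apply: contrapT => nI; apply: (aP q); split.
  by move=> h; apply: (aP q); split.
apply: (@card_le_fun _ _ a) => [q /fresh[]//|p q Dp Dq apq].
case: (tot p q) => // [pq|qp].
  by case: (fresh q Dq) => _ []; exists p.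
by case: (fresh p Dp) => _ []; exists q.
Qed.

Lemma card_le_total {T U} (A : set T) (B : set U) : A #<= B \/ B #<= A.
Proof.
have [|nBA] := pselect (B #<= A); [by right|left].
have [lt wo] := strict_wo_exists A.
rewrite -(card_le_eql (card_setT A)).
apply: (@greedy_card_le _ _ lt) => // q _ Bq; apply: nBA.
apply: card_le_trans Bq _; apply: card_le_trans (card_leT _) _.
by rewrite (card_le_eql (card_setT A)).
Qed.

(** Cut an arbitrary well-order at the first segment that is as large as [T]
    and transport the order of that segment to [T]. *)
Lemma initial_wo_exists (T : Type) : exists2 lt : T -> T -> Prop, strict_wo lt &
  forall w, ~ ([set: T] #<= seg lt w).
Proof.
have [lt wo] := strict_wo_exists T.
have [nT|] := pselect (forall w, ~ ([set: T] #<= seg lt w)); first by exists lt.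
move=> /existsNP[w0 /contrapT Tw0].
have [|w Tw wmin] := wo_min wo (A := [set w | [set: T] #<= seg lt w]).
  by exists w0.
have [f fw finj] : exists2 f : T -> T, (forall x, lt (f x) w) &
    injective f.
  have [|f fw fi] := card_le_funP Tw; first by exists w0.
  by exists f => [x|x y]; [exact: fw|exact: fi].
have [wf tr tot] := wo.
exists (fun x y => lt (f x) (f y)).
  split.
  - move=> x; move Ey : (f x) => y; elim/(well_founded_ind wf): y x Ey => y IH x.
    by move=> fx; constructor => u; rewrite fx => /IH; apply.
  - by move=> x y z; exact: tr.
  - move=> x y; case: (tot (f x) (f y)) => [?|/finj|?].
    + exact: Or31.
    + exact: Or32.
    + exact: Or33.
move=> x Tx; apply: (wmin (f x)) => //=; apply: card_le_trans Tx _.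
by apply: (@card_le_fun _ _ f) => // u v _ _; exact: finj.
Qed.

(** * Arithmetic of infinite cardinals *)

(** Shift a sequence of distinct points of [A], as in the Hilbert hotel. *)
Lemma infinite_setU1 {T} (A : set T) (x : T) :
  infinite_set A -> A `|` [set x] #<= A.
Proof.
move=> /[dup] Ainf /infiniteP/card_le_funP[|g gA ginj]; first by exists 0%N.
have [Ax|nAx] := pselect (A x).
  by apply: subset_card_le => y [//|->].
pose R y z := [\/ y = x /\ z = g 0%N,
  (exists2 n, y = g n & z = g n.+1) | [/\ y <> x, ~ (exists n, y = g n) & z = y]].
have gx n : g n <> x by move=> gx; apply: nAx; rewrite -gx; exact: gA.
have gi m n : g m = g n -> m = n by exact: ginj.
apply: (@card_le_rel _ _ R).
  move=> y [Ay|->]; last by exists (g 0%N); [exact: gA|apply: Or31].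
  have [[n yn]|yn] := pselect (exists n, y = g n).
    by exists (g n.+1); [exact: gA|apply: Or32; exists n].
  by exists y => //; apply: Or33; split=> // yx; apply: nAx; rewrite -yx.
move=> y y' z _ _ _ [[-> ->]|[n -> ->]|[yx yn ->]].
- by case=> [[-> //]|[m _ /gi//]|[_ h g0]]; case: h; exists 0%N.
- case=> [[_ /gi//]|[m -> /gi [->]//]|[_ h gn]].
  by case: h; exists n.+1.
- case=> [[-> y0]|[m -> ym]|[_ _ //]]; first by case: yn; exists 0%N.
  by case: yn; exists m.+1.
Qed.

Section Square.
Context {T : Type} {lt : T -> T -> Prop} (lt_wo : strict_wo lt).

(** Well-order the pairs first by their maximum. The pairs that precede a given
    one lie in the square of a shorter segment, so there are fewer of them than
    elements of [I], and [greedy_card_le] applies. Inside one level of the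
    maximum any well-order will do. *)
Lemma infinite_square_step (I : set T) : infinite_set I ->
    (forall v w, lt v w -> I w -> I v) ->
    (forall w, I w -> ~ (I #<= seg lt w)) ->
    (forall w, I w -> infinite_set (seg lt w) ->
      seg lt w `*` seg lt w #<= seg lt w) ->
  I `*` I #<= I.
Proof.
move=> Iinf Idown Ismall Isq.
have [lt' [wf' tr' tot']] := strict_wo_exists (T * T)%type.
have [wf tr tot] := lt_wo.
pose m (p : T * T) := if pselect (lt p.1 p.2) then p.2 else p.1.
pose lt2 p q := lt (m p) (m q) \/ (m p = m q /\ lt' p q).
have wo2 : strict_wo lt2.
  split.
  - move=> p; move Ep : (m p) => x; elim/(well_founded_ind wf): x p Ep => x IH.
    move=> p; elim/(well_founded_ind wf'): p => p IHp pE.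
    constructor => q [|[qp]]; first by rewrite pE => /IH; apply.
    by move=> /IHp; apply; rewrite qp.
  - move=> p q r [pq|[pq pq']] [qr|[qr qr']].
    + by left; exact: tr qr.
    + by left; rewrite -qr.
    + by left; rewrite pq.
    + by right; split; [rewrite pq|exact: tr' qr'].
  - move=> p q; case: (tot (m p) (m q)) => [?|pq|?].
    + by apply: Or31; left.
    + case: (tot' p q) => [?|?|?]; [apply: Or31|exact: Or32|apply: Or33].
        by right.
      by right.
    + by apply: Or33; left.
have mI p : (I `*` I) p -> I (m p) by rewrite /m => -[]; case: pselect.
have mle p x : I (m p) -> p.1 = x \/ p.2 = x -> x = m p \/ lt x (m p).
  rewrite /m; case: pselect => h _ [] <- /=; [by right|by left|by left|].
  by case: (tot p.1 p.2) => [//|/esym|]; [left|right].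
have Ile p : I (m p) -> (I `*` I) p.
  move=> Im; split => /=.
    by have [->//|/Idown] := mle _ _ Im (or_introl erefl); exact.
  by have [->//|/Idown] := mle _ _ Im (or_intror erefl); exact.
apply: (greedy_card_le wo2) => [p q [|[]]|q Iq].
- by move=> pq /mI Iq; apply: Ile; apply: Idown Iq.
- by move=> pq _ /mI Iq; apply: Ile; rewrite pq.
pose J := seg lt (m q) `|` [set m q].
move=> I2; have IJ : I #<= J `*` J.
  apply: card_le_trans I2 _; apply: subset_card_le => p pq.
  have mpq : m p = m q \/ lt (m p) (m q) by case: pq => [|[]]; [right|left].
  have Im : I (m p).
    by case: mpq => [->|/Idown]; [|apply]; exact: mI.
  suff h x : p.1 = x \/ p.2 = x -> J x by split; apply: h; [left|right].
  move=> /(mle _ _ Im)[->|xm]; first by case: mpq => ?; [right|left].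
  by left; case: mpq => [<-//|]; exact: tr.
have [fin|inf] := pselect (finite_set (seg lt (m q))).
  apply: Iinf; apply: card_le_finite IJ _; apply: finite_setX;
    by rewrite finite_setU; split => //; exact: finite_set1.
apply: (Ismall (m q)); first exact: mI.
apply: card_le_trans IJ _.
apply: card_le_trans (Isq _ (mI _ Iq) inf).
by apply: card_leX; exact: infinite_setU1.
Qed.

Lemma infinite_square_seg w : infinite_set (seg lt w) ->
  seg lt w `*` seg lt w #<= seg lt w.
Proof.
have [wf tr _] := lt_wo.
elim/(well_founded_ind wf): w => w IH inf.
have [[v vw wv]|small] := pselect (exists2 v, lt v w & seg lt w #<= seg lt v).
  apply: card_le_trans (card_leX wv wv) _; apply: card_le_trans (IH v vw _) _.
    exact: infinite_le inf.
  by apply: subset_card_le => u uv; exact: tr vw.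
apply: infinite_square_step => // [u v uv vw|v vw wv]; first exact: tr vw.
by apply: small; exists v.
Qed.

End Square.

Lemma infinite_square_setT T : infinite_set [set: T] ->
  [set: T] `*` [set: T] #<= [set: T].
Proof.
have [lt wo small] := initial_wo_exists T => inf.
apply: (infinite_square_step wo) => // w _; exact: infinite_square_seg.
Qed.

Lemma infinite_square {T} (A : set T) : infinite_set A -> A `*` A #<= A.
Proof.
move=> inf; have := card_setT A; rewrite card_eq_le => /andP[TA AT].
apply: card_le_trans (card_leX AT AT) _.
apply: card_le_trans TA; apply: infinite_square_setT; exact: infinite_le inf.
Qed.

Lemma infinite_setX_le {T U V} (A : set T) (B : set U) (C : set V) :
  infinite_set C -> A #<= C -> B #<= C -> A `*` B #<= C.
Proof.
by move=> inf leAC leBC; apply: card_le_trans (card_leX leAC leBC) (infinite_square inf).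
Qed.

Lemma infinite_bigcup_le {I T U} (D : set I) (F : I -> set T) (C : set U) :
    infinite_set C -> D #<= C -> (forall i, D i -> F i #<= C) ->
  \bigcup_(i in D) F i #<= C.
Proof.
move=> inf DC FC; apply: card_le_trans (infinite_setX_le inf DC (card_lexx C)).
have [z0 _] : C !=set0.
  exact: infinite_setN0.
have /choice[f fP] i : exists f : T -> U, D i ->
    (forall x, F i x -> C (f x)) /\
    (forall x y, F i x -> F i y -> f x = f y -> x = y).
  have [Di|nDi] := pselect (D i); last by exists (fun=> z0).
  have [F0|/set0P Fi] := eqVneq (F i) set0; first by exists (fun=> z0); rewrite F0.
  by have [f ? ?] := card_le_funP (FC i Di) Fi; exists f.
apply: (@card_le_rel _ _ (fun x p => F p.1 x /\ p.2 = f p.1 x)).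
  move=> x [i Di Fix]; exists (i, f i x) => //; split => //=.
  by have [h _] := fP i Di; exact: h.
move=> x y [i z] _ _ [/= Di Cz] [Fx ->] [Fy]; have [_ h] := fP i Di.
exact: h.
Qed.

Lemma infinite_setU_le {T U} (A B : set T) (C : set U) :
  infinite_set C -> A #<= C -> B #<= C -> A `|` B #<= C.
Proof.
move=> inf leAC leBC.
have -> : A `|` B = \bigcup_(i in [set: bool]) (if i then A else B).
  apply/seteqP; split=> [x [?|?]|x [[] _ ?]]; [by exists true|by exists false|by left|by right].
apply: infinite_bigcup_le => //; last by case.
exact: finite_le_infinite (finite_finset) _.
Qed.

Lemma small_setX {T U V} (K : set T) (A : set U) (B : set V) :
    infinite_set K -> ~ (K #<= A) -> ~ (K #<= B) -> ~ (K #<= A `*` B).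
Proof.
move=> inf KA KB KAB.
have [/[dup] fA|iA] := pselect (finite_set A); have [fB|iB] := pselect (finite_set B).
- by move=> _; apply: inf; apply: card_le_finite KAB _; exact: finite_setX.
- move=> _; apply: KB; apply: card_le_trans KAB _.
  by apply: infinite_setX_le => //; exact: finite_le_infinite.
- apply: KA; apply: card_le_trans KAB _.
  by apply: infinite_setX_le => //; exact: finite_le_infinite.
- have [AB|BA] := card_le_total A B.
    by apply: KB; apply: card_le_trans KAB _; exact: infinite_setX_le.
  by apply: KA; apply: card_le_trans KAB _; exact: infinite_setX_le.
Qed.

Lemma small_setU {T U} (K : set T) (A B : set U) :
    infinite_set K -> ~ (K #<= A) -> ~ (K #<= B) -> ~ (K #<= A `|` B).
Proof.
move=> inf KA KB KAB.
have [/[dup] fA|iA] := pselect (finite_set A); have [fB|iB] := pselect (finite_set B).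
- by move=> _; apply: inf; apply: card_le_finite KAB _; rewrite finite_setU.
- move=> _; apply: KB; apply: card_le_trans KAB _.
  by apply: infinite_setU_le => //; exact: finite_le_infinite.
- apply: KA; apply: card_le_trans KAB _.
  by apply: infinite_setU_le => //; exact: finite_le_infinite.
- have [AB|BA] := card_le_total A B.
    by apply: KB; apply: card_le_trans KAB _; exact: infinite_setU_le.
  by apply: KA; apply: card_le_trans KAB _; exact: infinite_setU_le.
Qed.

(** * Generated subgroups *)

Definition subgroup {G : groupType} (H : set G) : Prop :=
  H 1%g /\ forall x y, H x -> H y -> H (x / y)%g.

Section Subgroup.
Context {G : groupType} {H : set G} (sH : subgroup H).

Lemma subgroup1 : H 1%g. Proof. by case: sH. Qed.

Lemma subgroupV x : H x -> H x^-1%g.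
Proof. by case: sH => H1 HD Hx; rewrite -[(x^-1)%g]mul1g; exact: HD. Qed.

Lemma subgroupM x y : H x -> H y -> H (x * y)%g.
Proof. by case: sH => _ HD Hx /subgroupV Hy; rewrite -[y]invgK; exact: HD. Qed.

End Subgroup.

Section Generated.
Context {G : groupType}.
Implicit Types S H : set G.

Fixpoint gen_step S n : set G :=
  if n is n'.+1 then
    [set (p.1 / p.2)%g | p in gen_step S n' `*` gen_step S n']
  else S `|` [set 1%g].

Definition gen S : set G := \bigcup_n gen_step S n.

Lemma gen_step1 S n : gen_step S n 1%g.
Proof.
elim: n => [|n IH] /=; first by right.
by exists (1, 1)%g; rewrite ?divg1.
Qed.

Lemma gen_step_leq S m n : (m <= n)%N -> gen_step S m `<=` gen_step S n.
Proof.
move=> /subnK <-; elim: (n - m)%N => [//|k IH] x /IH xk.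
by exists (x, 1)%g; rewrite ?divg1//; split => //; exact: gen_step1.
Qed.

Lemma sub_gen S : S `<=` gen S.
Proof. by move=> x Sx; exists 0%N => //; left. Qed.

Lemma gen_subgroup S : subgroup (gen S).
Proof.
split; first by exists 0%N => //; right.
move=> x y [m _ xm] [n _ yn]; exists (maxn m n).+1 => //.
exists (x, y) => //; split => /=; first exact: gen_step_leq (leq_maxl m n) _ xm.
exact: gen_step_leq (leq_maxr m n) _ yn.
Qed.

Lemma gen_min S H : subgroup H -> S `<=` H -> gen S `<=` H.
Proof.
move=> [H1 HD] SH x [n _]; elim: n x => [|n IH] x /=.
  by move=> [/SH|->].
by move=> [[u v] [/= /IH Hu /IH Hv] <-]; exact: HD.
Qed.

Lemma gen_card_le {U} S (C : set U) :
  infinite_set C -> S #<= C -> gen S #<= C.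
Proof.
move=> inf SC; apply: infinite_bigcup_le => //; first exact/infiniteP.
move=> n _; elim: n => [|n IH] /=.
  apply: infinite_setU_le => //.
  exact: finite_le_infinite (finite_set1 _) inf.
by apply: card_le_trans (card_image_le _ _) _; exact: infinite_setX_le.
Qed.

End Generated.

(** * Towers of subgroups and supports *)

(** Each [M w] is to be thought of as the subgroup generated by the elements
    before [w] and the [a v] with [v] before [w]. The facts listed are all that
    is used of this subgroup: [a w] is new at stage [w], and [M w] is no larger
    than the segment of [w], up to making it infinite. *)
Record tower {G : groupType} (lt : G -> G -> Prop) (M : G -> set G)
    (a : G -> G) : Prop := Tower {
  tower_subgroup : forall w, subgroup (M w);
  tower_mono : forall v w, lt v w -> M v `<=` M w;
  tower_fresh : forall w, ~ M w (a w);
  tower_mem : forall v w, lt v w -> M w (a v);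
  tower_card : forall U (C : set U) w,
    infinite_set C -> seg lt w #<= C -> M w #<= C }.

(** The set [L] only witnesses that [G] is uncountable: the subgroup generated
    by a finite segment is countable, and it has to miss a point of [G]. *)
Lemma tower_exists (G : groupType) (lt : G -> G -> Prop) (U : Type) (L : set U) :
    strict_wo lt -> infinite_set L -> L #<= [set: G] -> ~ ([set: G] #<= L) ->
    (forall w, ~ ([set: G] #<= seg lt w)) ->
  exists M a, tower lt M a.
Proof.
move=> wo infL LG GL small; have [wf tr tot] := wo.
have smallU (w : G) (S : set G) : S #<= seg lt w ->
    exists t, ~ gen (seg lt w `|` S) t.
  move=> Sw; apply/existsNP => all.
  have GwS (V : Type) (C : set V) : infinite_set C -> seg lt w #<= C -> ~ ([set: G] #<= C) -> False.
    move=> inf wC; apply; apply: card_le_trans (subset_card_le _) _.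
      by move=> t _; exact: (all t).
    apply: gen_card_le => //; apply: infinite_setU_le => //.
    exact: card_le_trans wC.
  have [wfin|winf] := pselect (finite_set (seg lt w)).
    by apply: (GwS _ L) => //; exact: finite_le_infinite.
  exact: (GwS _ (seg lt w)).
have [a aP] := greedy (Phi := fun w S => gen (seg lt w `|` S)) wf smallU.
pose M w := gen (seg lt w `|` a @` seg lt w).
exists M, a; split.
- by move=> w; exact: gen_subgroup.
- move=> v w vw; apply: gen_min; first exact: gen_subgroup.
  move=> x xv; apply: sub_gen; case: xv => [xv|[u uv <-]]; [left|right].
    exact: tr vw.
  by exists u => //; exact: tr vw.
- exact: aP.
- by move=> v w vw; apply: sub_gen; right; exists v.
- move=> V C w inf wC; apply: gen_card_le => //; apply: infinite_setU_le => //.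
  exact: card_le_trans (card_image_le _ _) wC.
Qed.

Definition setmul {G : groupType} (A B : set G) : set G :=
  [set (p.1 * p.2)%g | p in A `*` B].

Section Tower.
Context {G : groupType} {lt : G -> G -> Prop} {M : G -> set G} {a : G -> G}.
Hypothesis lt_wo : strict_wo lt.
Hypothesis Ma : tower lt M a.

Lemma tower_inj b c : a b = a c -> b = c.
Proof.
have [_ _ tot] := lt_wo; case: (tot b c) => // h e.
  by case: (tower_fresh Ma (w := c)); rewrite -e; exact: (tower_mem Ma h).
by case: (tower_fresh Ma (w := b)); rewrite e; exact: (tower_mem Ma h).
Qed.

(** If the two quotients were equal, the relation could be solved for the
    [a b] of largest index [b], which would then lie in [M b]. *)
Lemma tower_quotient_neq b1 b2 b3 b4 :
    b1 <> b2 -> b3 <> b4 -> b1 <> b3 -> b1 <> b4 -> b2 <> b3 -> b2 <> b4 ->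
  (a b1 / a b2 <> a b3 / a b4)%g.
Proof.
have sM w := tower_subgroup Ma w; have mem := tower_mem Ma.
have fresh b x y z : M b (a x) -> M b (a y) -> M b (a z) ->
    [/\ (a b / a x <> a y / a z)%g, (a x / a b <> a y / a z)%g,
        (a y / a z <> a b / a x)%g & (a y / a z <> a x / a b)%g].
  move=> Mx My Mz; have h1 : (a b / a x <> a y / a z)%g.
    move=> e; apply: (tower_fresh Ma (w := b)).
    by rewrite -[a b](mulgVK (a x)) e; do 2?[apply: subgroupM => //]; exact: subgroupV.
  have h2 : (a x / a b <> a y / a z)%g.
    move=> e; apply: (tower_fresh Ma (w := b)).
    have -> : a b = (a z / a y * a x)%g.
      by rewrite -[(a z / a y)%g]invgK invgF -e invgF mulgVK.
    by do 2?[apply: subgroupM => //]; exact: subgroupV.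
  by split=> //; exact/nesym.
have [_ tr tot] := lt_wo.
have max2 x y : x <> y -> exists2 z, z = x \/ z = y &
   (forall u, u = x \/ u = y -> u = z \/ lt u z).
  move=> xy; case: (tot x y) => // h; [exists y|exists x]; try by [left|right].
    by move=> u [] ->; [right|left].
  by move=> u [] ->; [left|right].
move=> h12 h34 h13 h14 h23 h24.
have [m m12 mP] := max2 _ _ h12; have [n n34 nP] := max2 _ _ h34.
have mn : m <> n by case: m12 => ->; case: n34 => ->.
have memle u w v : u = w \/ lt u w -> lt w v -> M v (a u).
  by move=> [->|uw] wv; [exact: mem|apply: mem; exact: tr wv].
case: (tot m n) => // [mltn|nltm].
  have M1 : M n (a b1) by apply: (memle _ m) => //; apply: mP; left.
  have M2 : M n (a b2) by apply: (memle _ m) => //; apply: mP; right.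
  case: n34 => nE; move: M1 M2; rewrite nE => M1 M2.
    have [|e|lt4] := nP b4; [by right|by case: h34; rewrite e nE|].
    have M4 : M b3 (a b4) by apply: mem; rewrite -nE.
    by have [_ _ + _] := fresh b3 b4 b1 b2 M4 M1 M2.
  have [|e|lt3] := nP b3; [by left|by case: h34; rewrite e nE|].
  have M3 : M b4 (a b3) by apply: mem; rewrite -nE.
  by have [_ _ _ +] := fresh b4 b3 b1 b2 M3 M1 M2.
have M3 : M m (a b3) by apply: (memle _ n) => //; apply: nP; left.
have M4 : M m (a b4) by apply: (memle _ n) => //; apply: nP; right.
case: m12 => mE; move: M3 M4; rewrite mE => M3 M4.
  have [|e|lt2] := mP b2; [by right|by case: h12; rewrite e mE|].
  have M2 : M b1 (a b2) by apply: mem; rewrite -mE.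
  by have [] := fresh b1 b2 b3 b4 M2 M3 M4.
have [|e|lt1] := mP b1; [by left|by case: h12; rewrite e mE|].
have M1 : M b2 (a b1) by apply: mem; rewrite -mE.
by have [] := fresh b2 b1 b3 b4 M1 M3 M4.
Qed.

Definition next (b : G) : set G := gen (M b `|` [set a b]).

Lemma next_subgroup b : subgroup (next b). Proof. exact: gen_subgroup. Qed.

Lemma sub_next b : M b `<=` next b.
Proof. by move=> x Mx; apply: sub_gen; left. Qed.

Lemma next_mem b : next b (a b). Proof. by apply: sub_gen; right. Qed.

Lemma next_sub b c : lt b c -> next b `<=` M c.
Proof.
move=> bc; apply: gen_min; first exact: tower_subgroup Ma c.
by move=> x [/(tower_mono Ma bc)//|->]; exact: (tower_mem Ma bc).
Qed.

(** The sets [M b * C] grow with [b], so their least elements decrease; the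
    support of [C] is the set of stages [b] at which the least element drops
    when [M b] is replaced with [next b]. It plays the role of the set of levels of
    a normal form, without any choice of coset representatives. *)
Definition supp (C : set G) : set G :=
  [set b | exists2 z, setmul (next b) C z & forall u, setmul (M b) C u -> lt z u].

(** The least elements strictly decrease along the support, and a decreasing
    sequence in a well-order is finite. The induction is on an element [z] that
    lies weakly above the least element reached so far. *)
Lemma supp_finite C : C !=set0 -> finite_set (supp C).
Proof.
move=> [c Cc]; have [wf tr tot] := lt_wo.
pose D z := [set b | supp C b /\ exists2 u, setmul (M b) C u & ~ lt z u].
suff Dfin z : finite_set (D z).
  apply: sub_finite_set (Dfin c) => b sb; split => //; exists c; last exact: wo_irr.
  by exists (1%g, c); rewrite /= ?mul1g//; split => //; exact: subgroup1 (tower_subgroup Ma b).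
elim/(well_founded_ind wf): z => z IH.
have [->|/set0P Dn] := eqVneq (D z) set0; first exact: finite_set0.
have [b0 [[z0 z0n z0l] [u uM uz]] bmin] := wo_min lt_wo Dn.
have z0z : lt z0 z.
  have z0u := z0l _ uM.
  by case: (tot u z) => [uz'|<-//|//]; exact: tr uz'.
apply: (@sub_finite_set _ _ ([set b0] `|` D z0)); last first.
  by rewrite finite_setU; split; [exact: finite_set1|exact: IH].
move=> b Db; case: (tot b0 b) => [b0b|->|/(bmin _ Db)//]; [right|by left].
split; first by case: Db.
exists z0; last exact: wo_irr.
case: z0n => -[m c0] [/= /(next_sub b0b) Mm Cc0] <-.
by exists (m, c0).
Qed.

(** Multiplying by [a b] does not change [next b * C]. When [b] is not in the
    support, the least element of this set lies in [M b * C], hence outside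
    the disjoint set [M b * a b * C]: for [a b * C], stage [b] is a drop. *)
Lemma supp_shift C b : C !=set0 ->
    (forall c c', C c -> C c' -> ~ M b (a b * c / c')%g) ->
    ~ supp C b ->
  supp [set (a b * c)%g | c in C] b.
Proof.
move=> [c0 Cc0] disj nsupp; have [wf tr tot] := lt_wo.
have sM := tower_subgroup Ma b; have sN := next_subgroup b.
have [|z zn zmin] := wo_min lt_wo (A := setmul (next b) C).
  by exists c0; exists (1%g, c0); rewrite /= ?mul1g//; split => //; exact: subgroup1 sN.
have [u uM zu] : exists2 u, setmul (M b) C u & ~ lt z u.
  apply: contrapT => nex; apply: nsupp; exists z => // u uM.
  by apply: contrapT => zu; apply: nex; exists u.
have sub : setmul (M b) C `<=` setmul (next b) C.
  by move=> _ [[m c] [/= /sub_next Mm Cc] <-]; exists (m, c).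
have uz : u = z by case: (tot u z) => [/(zmin _ (sub _ uM))//|//|//].
rewrite uz in uM.
exists z.
  case: zn => -[n c] [/= nn Cc] <-; exists ((n / a b)%g, (a b * c)%g).
    split => /=; last by exists c.
    by apply: (subgroupM sN) => //; apply: (subgroupV sN); exact: next_mem.
  by rewrite /= mulgA mulgVK.
move=> _ [[m _] [/= Mm [c Cc <-]] <-].
case: (tot z (m * (a b * c))%g) => // [zE|h].
  case: uM => -[m' c'] [/= Mm' Cc'] zE'.
  case: (disj c c') => //.
  have -> : (a b * c / c' = m^-1 * m')%g.
    by rewrite -[m'](mulgK c') zE' zE -!mulgA mulKg.
  by apply: (subgroupM sM) => //; exact: (subgroupV sM).
exfalso; apply: (zmin _ _ h); exists ((m * a b)%g, c); last by rewrite /= mulgA.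
split => //=; apply: (subgroupM sN); [exact: sub_next|exact: next_mem].
Qed.

End Tower.

Arguments supp {G} lt M a C _.

(** * One-sided thick families *)

Section Components.
Context {Q V : Type} (link : Q -> Q -> Prop) (N : set V).
Hypothesis link_sym : forall p q, link p q -> link q p.
Hypothesis N_inf : infinite_set N.
Hypothesis link_card : forall q, [set q' | link q q'] #<= N.

Fixpoint ball (q : Q) (n : nat) : set Q :=
  if n is n'.+1 then \bigcup_(p in ball q n') [set q' | link p q'] else [set q].

Definition component q : set Q := \bigcup_n ball q n.

Lemma component_refl q : component q q.
Proof. by exists 0%N. Qed.

Lemma component_trans p q r :
  component p q -> component q r -> component p r.
Proof.
move=> [m _ pq] [n _]; elim: n r => [|n IH] r /=.
  by move=> ->; exists m.
by move=> [s /IH[k _ ps] sr]; exists k.+1 => //; exists s.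
Qed.

Lemma component_link p q : link p q -> component p q.
Proof. by move=> pq; exists 1%N => //; exists p. Qed.

Lemma component_sym p q : component p q -> component q p.
Proof.
move=> [n _]; elim: n q => [|n IH] q /=.
  by move=> ->; exact: component_refl.
move=> [r /IH rp rq]; apply: component_trans rp.
exact/component_link/link_sym.
Qed.

Lemma component_eq p q : component p q -> component p = component q.
Proof.
move=> pq; apply/seteqP; split=> r; apply: component_trans => //.
exact: component_sym.
Qed.

Lemma component_card q : component q #<= N.
Proof.
apply: infinite_bigcup_le => //; first exact/infiniteP.
move=> n _; elim: n => [|n IH] /=.
  exact: finite_le_infinite (finite_set1 _) N_inf.
exact: infinite_bigcup_le.
Qed.

(** Each component has at most as many vertices as [N] has elements, so its
    vertices can be numbered without repetition by elements of [N]. *)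
Lemma component_rank : exists e : Q -> V, (forall q, N (e q)) /\
  forall p q, component p q -> e p = e q -> p = q.
Proof.
have [v0 _] := infinite_setN0 N_inf.
have /choice[f fP] (K : set Q) : exists f : Q -> V, K #<= N -> K !=set0 ->
    (forall x, K x -> N (f x)) /\
    (forall x y, K x -> K y -> f x = f y -> x = y).
  have [[KN K0]|h] := pselect (K #<= N /\ K !=set0).
    by have [f ? ?] := card_le_funP KN K0; exists f.
  by exists (fun=> v0) => ? ?; case: h.
have fC q := fP _ (component_card q) (ex_intro _ _ (component_refl q)).
exists (fun q => f (component q) q); split.
  by move=> q; have [+ _] := fC q; apply; exact: component_refl.
move=> p q pq; rewrite -(component_eq pq).
have [_] := fC p; apply => //; exact: component_refl.
Qed.

End Components.

Section OneSided.
Context {G : groupType} {U : Type} {L : set U} {N : set G}.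
Context {lt : G -> G -> Prop} {M : G -> set G} {a : G -> G}.
Context {p : G * G -> G}.
Hypothesis lt_wo : strict_wo lt.
Hypothesis Ma : tower lt M a.
Hypothesis L_inf : infinite_set L.
Hypothesis N_inf : infinite_set N.
Hypothesis N_seg : forall w, N w -> seg lt w #<= L.
Hypothesis NL : ~ (N #<= L).
Hypothesis p_inj : forall x y, p x = p y -> x = y.

(** A request [(y, d)] asks for colour [d] on some translate [a b * y] where [b]
    ranges over the indices [p (d, xi)] attached to [d]. Only indices outside
    the support of [y] are used, so that [supp_shift] applies to the translate. *)
Definition claims (q : G * G) (z : G) : Prop :=
  exists xi, [/\ N xi, ~ supp lt M a [set q.1] (p (q.2, xi)) &
    z = (a (p (q.2, xi)) * q.1)%g].

Definition rival q q' := exists2 z, claims q z & claims q' z.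

Lemma rival_sym q q' : rival q q' -> rival q' q.
Proof. by move=> [z ? ?]; exists z. Qed.

(** A request that claims [z] is determined by an index in the support of [z]. *)
Lemma claimants_finite z : finite_set [set q | claims q z].
Proof.
apply: (@card_le_finite _ _ _ (supp lt M a [set z])); last first.
  by apply: supp_finite Ma _ _ => //; exists z.
apply: (@card_le_rel _ _ (fun q b => (exists xi, b = p (q.2, xi)) /\
    z = (a b * q.1)%g)).
  move=> [y d] [xi /= [Nxi ns zE]]; exists (p (d, xi)); last first.
    by split => //; exists xi.
  have := supp_shift lt_wo Ma (C := [set y]) (b := p (d, xi)).
  rewrite image_set1 -zE; apply => //; first by exists y.
  by move=> _ _ -> ->; rewrite mulgK; exact: tower_fresh Ma _.
move=> [y d] [y' d'] b _ _ _ [[xi /= ->] zE] [[xi' /p_inj [<- _]] /= zE'].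
congr (_, _); apply: (@mulgI _ (a (p (d, xi)))); by rewrite -zE.
Qed.

Lemma rival_card q : [set q' | rival q q'] #<= N.
Proof.
have -> : [set q' | rival q q'] =
    \bigcup_(z in [set z | claims q z]) [set q' | claims q' z].
  by apply/seteqP; split=> q' [z]; exists z.
apply: infinite_bigcup_le => //; last first.
  by move=> z _; apply: finite_le_infinite => //; exact: claimants_finite.
apply: card_le_trans (subset_card_le _)
  (card_image_le (fun xi => (a (p (q.2, xi)) * q.1)%g) N).
by move=> z [xi [Nxi _ ->]]; exists xi.
Qed.

(** Two requests of different colours compete for at most one element, since
    two common elements would give a quotient relation among four of the [a b]. *)
Lemma rival_unique y d y' d' xi1 xi2 b1 b2 : d <> d' ->
    (a (p (d, xi1)) * y = a (p (d', b1)) * y')%g ->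
    (a (p (d, xi2)) * y = a (p (d', b2)) * y')%g ->
  xi1 = xi2.
Proof.
move=> dd e1 e2; apply: contrapT => xi12.
have aI := tower_inj lt_wo Ma.
have b12 : b1 <> b2.
  move=> b12; move: e1; rewrite b12 -e2 => /mulIg /aI /p_inj[].
  exact: xi12.
apply: (tower_quotient_neq lt_wo Ma (b1 := p (d, xi1)) (b2 := p (d, xi2))
  (b3 := p (d', b1)) (b4 := p (d', b2))); try by move=> /p_inj[].
have := congr1 (fun x => x / (a (p (d, xi2)) * y))%g e1.
by rewrite {2}e2 !mulgKA.
Qed.

(** An element gets colour [d] if, among the requests that claim it, one of
    colour [d] has smaller rank than all those of other colours. A request [q]
    loses one translate at most to each rival of smaller rank; these rivals are
    numbered injectively by [seg lt (e q)], so at most [L] of the translates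
    indexed by [N] are lost, and [L] many requests with the same colour still
    have a common successful index. *)
Theorem one_sided_family : exists A : G -> set G,
  (forall d d' z, A d z -> A d' z -> d = d') /\
  forall d (F : set G), F #<= L -> exists u, forall y, F y -> A d (u * y)%g.
Proof.
have [e [eN einj]] := component_rank rival_sym N_inf rival_card.
have [wf tr tot] := lt_wo.
pose A d z := exists2 y, claims (y, d) z &
  forall q', claims q' z -> q'.2 <> d -> lt (e (y, d)) (e q').
exists A; split.
  move=> d d' z [y yz h] [y' yz' h']; apply: contrapT => dd.
  by apply: (wo_asym lt_wo (h _ yz' (nesym dd))); exact: h'.
move=> d F FL.
(* The indices at which the request of [y] is not made, or is lost. *)
pose B1 y := [set xi | supp lt M a [set y] (p (d, xi))].
pose B2 y := [set xi | [/\ N xi, ~ supp lt M a [set y] (p (d, xi)) &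
  exists2 q', claims q' (a (p (d, xi)) * y)%g & q'.2 <> d /\ lt (e q') (e (y, d))]].
have B1L y : B1 y #<= L.
  apply: finite_le_infinite => //.
  apply: (@card_le_finite _ _ _ (supp lt M a [set y])); last first.
    by apply: supp_finite Ma _ _ => //; exists y.
  by apply: (@card_le_fun _ _ (fun xi => p (d, xi))) => // x x' _ _ /p_inj[].
have B2L y : B2 y #<= L.
  apply: card_le_trans (N_seg (eN (y, d))).
  apply: (@card_le_rel _ _ (fun xi v => N xi /\ ~ supp lt M a [set y] (p (d, xi)) /\
    exists2 q', claims q' (a (p (d, xi)) * y)%g & q'.2 <> d /\ v = e q')).
    move=> xi [Nxi nxi [q' cq' [dq' lq']]]; exists (e q') => //.
    by split => //; split => //; exists q'.
  move=> xi1 xi2 v _ _ _ [N1 [n1 [q1 c1 [d1 ->]]]] [N2 [n2 [q2 c2 [d2 eE]]]].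
  have r1 : rival (y, d) q1.
    by exists (a (p (d, xi1)) * y)%g => //; exists xi1.
  have r2 : rival (y, d) q2.
    by exists (a (p (d, xi2)) * y)%g => //; exists xi2.
  have q12 : q1 = q2.
    apply: einj eE; apply: component_trans (component_link r2).
    exact/component_link/rival_sym.
  case: c1 => b1 [_ _ e1]; case: c2 => b2 [_ _]; rewrite -q12 => e2.
  exact: rival_unique (nesym d1) e1 e2.
have [xi Nxi good] : exists2 xi, N xi & forall y, F y -> ~ B1 y xi /\ ~ B2 y xi.
  apply: contrapT => nex; apply: NL.
  apply: (@card_le_trans _ _ _ (\bigcup_(y in F) (B1 y `|` B2 y))); last first.
    by apply: infinite_bigcup_le => // y _; exact: infinite_setU_le.
  apply: subset_card_le => xi Nxi; apply: contrapT => nB; apply: nex.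
  by exists xi => // y Fy; split=> ?; apply: nB; exists y => //; [left|right].
exists (a (p (d, xi))) => y /good[nB1 nB2].
have cl : claims (y, d) (a (p (d, xi)) * y)%g by exists xi.
exists y => // q' cq' dq'; case: (tot (e (y, d)) (e q')) => // [eE|lq'].
  have /einj : component rival (y, d) q'.
    by apply: component_link; exists (a (p (d, xi)) * y)%g.
  by move=> /(_ eE) qE; case: dq'; rewrite -qE.
by case: nB2; split=> //; exists q'.
Qed.

End OneSided.

(** * Successor segments *)

(** When [C] is infinite and smaller than [T], this is an initial segment of
    order type the successor cardinal of [C]. *)
Definition below {T V} (lt : T -> T -> Prop) (C : set V) : set T :=
  [set w | seg lt w #<= C].

Section Below.
Context {T V : Type} {lt : T -> T -> Prop} {C : set V}.
Hypothesis lt_wo : strict_wo lt.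
Hypothesis C_inf : infinite_set C.
Hypothesis C_small : ~ ([set: T] #<= C).

(** The first point outside [below lt C] would have a segment contained in it,
    hence of size at most [C], and so would belong to it. *)
Lemma below_not_le : ~ (below lt C #<= C).
Proof.
move=> BC; have [|w /= nBw wmin] := wo_min lt_wo (A := ~` below lt C).
  apply/set0P/eqP => B0; apply: C_small; apply: card_le_trans BC.
  apply: subset_card_le => w _; apply: contrapT => nw.
  by have : (~` below lt C) w by []; rewrite B0.
apply: nBw; apply: card_le_trans BC; apply: subset_card_le => v vw.
by apply: contrapT => /wmin; apply.
Qed.

Lemma below_ge : C #<= below lt C.
Proof. by have [//|/below_not_le] := card_le_total C (below lt C). Qed.

Lemma below_infinite : infinite_set (below lt C).
Proof. exact: infinite_le below_ge C_inf. Qed.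

(** Regularity of successor cardinals. *)
Lemma below_bounded (S : set T) : S #<= C -> S `<=` below lt C ->
  exists2 w, below lt C w & forall s, S s -> lt s w.
Proof.
move=> SC SB; apply: contrapT => nex; apply: below_not_le.
apply: (@card_le_trans _ _ _ (\bigcup_(s in S) (seg lt s `|` [set s]))).
  apply: subset_card_le => w Bw; apply: contrapT => nw; apply: nex.
  exists w => // s Ss; have [_ _ tot] := lt_wo; case: (tot s w) => // [sw|ws].
    by case: nw; exists s => //; right.
  by case: nw; exists s => //; left.
apply: infinite_bigcup_le => // s /SB Bs; apply: infinite_setU_le => //.
by apply: finite_le_infinite => //; exact: finite_set1.
Qed.

Lemma below_bound1 w : below lt C w -> exists2 w', below lt C w' & lt w w'.
Proof.
move=> Bw; have [||w' Bw' h] := @below_bounded [set w].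
- by apply: finite_le_infinite => //; exact: finite_set1.
- by move=> _ ->.
- by exists w' => //; exact: h.
Qed.

End Below.

(** * Encoding and two-sided thick families *)

Lemma coset_representative {G : groupType} (K : set G) : subgroup K ->
  exists rep : G -> G, (forall x, K ((rep x)^-1 * x)%g) /\
    forall x y, K (x^-1 * y)%g -> rep x = rep y.
Proof.
move=> sK; have /choice[f fP] (C : set G) : exists x, C !=set0 -> C x.
  by have [[x Cx]|] := pselect (C !=set0); [exists x|exists 1%g].
pose C (x : G) := [set y : G | K (y^-1 * x)%g].
exists (fun x => f (C x)); split.
  by move=> x; apply: (fP (C x)); exists x; rewrite /C /= mulVg; exact: subgroup1.
move=> x y Kxy; congr f; apply/seteqP; split=> z; rewrite /C /= => Kz.
  have -> : (z^-1 * y = (z^-1 * x) * (x^-1 * y))%g by rewrite mulgA mulgK.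
  exact: subgroupM.
have -> : (z^-1 * x = (z^-1 * y) * (x^-1 * y)^-1)%g.
  by rewrite invgM invgK mulgA mulgK.
by apply: subgroupM => //; exact: subgroupV.
Qed.

Section Decoding.
Context {G : groupType} {U : Type} {L : set U}.
Context {lt : G -> G -> Prop} {M : G -> set G} {a : G -> G}.
Hypothesis lt_wo : strict_wo lt.
Hypothesis Ma : tower lt M a.
Hypothesis L_inf : infinite_set L.
Hypothesis L_small : ~ ([set: G] #<= L).
Let N : set G := below lt L.
Hypothesis N_small : ~ ([set: G] #<= N).
Let W : set G := below lt N.

Let N_inf : infinite_set N. Proof. exact: below_infinite. Qed.
Let W_inf : infinite_set W. Proof. exact: below_infinite. Qed.

Let union_subgroup {V} (C : set V) : infinite_set C -> ~ ([set: G] #<= C) ->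
  subgroup (\bigcup_(w in below lt C) M w).
Proof.
move=> C_inf C_small; split.
  have [w Bw] := infinite_setN0 (below_infinite lt_wo C_inf C_small).
  by exists w => //; exact: subgroup1 (tower_subgroup Ma w).
have [_ _ tot] := lt_wo.
move=> x y [v Bv xv] [w Bw yw]; case: (tot v w) => h.
- exists w => //; have [_] := tower_subgroup Ma w; apply => //.
  exact: (tower_mono Ma h).
- by exists w => //; have [_] := tower_subgroup Ma w; apply => //; rewrite -h.
- exists v => //; have [_] := tower_subgroup Ma v; apply => //.
  exact: (tower_mono Ma h).
Qed.

(** [K] and [H] are subgroups of the sizes of [N] and [W], the first and second
    successors of [L]. *)
Let K : set G := \bigcup_(w in N) M w.
Let H : set G := \bigcup_(w in W) M w.

Let K_subgroup : subgroup K. Proof. exact: union_subgroup. Qed.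
Let H_subgroup : subgroup H. Proof. exact: union_subgroup. Qed.

Let K_card : K #<= N.
Proof.
apply: infinite_bigcup_le => // w Nw; apply: card_le_trans (below_ge lt_wo _) => //.
exact: (tower_card Ma).
Qed.

Let K_mem c : N c -> K (a c).
Proof.
move=> /(below_bound1 lt_wo L_inf L_small)[c' Nc' cc'].
by exists c' => //; exact: (tower_mem Ma).
Qed.

Let H_mem b : W b -> H (a b).
Proof.
move=> /(below_bound1 lt_wo N_inf N_small)[b' Wb' bb'].
by exists b' => //; exact: (tower_mem Ma).
Qed.

Section WithRepresentatives.
Context {rK rH : G -> G} {p : G * G -> G}.
Hypothesis rK_mem : forall x, K ((rK x)^-1 * x)%g.
Hypothesis rK_eq : forall x y, K (x^-1 * y)%g -> rK x = rK y.
Hypothesis rH_mem : forall y, H (y / rH y)%g.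
Hypothesis rH_eq : forall x y, H (x / y)%g -> rH x = rH y.
Hypothesis pW : forall xi w, N xi -> W w -> W (p (xi, w)).
Hypothesis p_inj : forall xi w xi' w', N xi -> W w -> N xi' -> W w' ->
  p (xi, w) = p (xi', w') -> xi = xi' /\ w = w'.

(** The coordinates of an element inside its left coset of [K] and inside its
    right coset of [H]. *)
Let tail x := ((rK x)^-1 * x)%g.
Let head y := (y / rH y)%g.
Let lcoset x : set G := [set z | K (x^-1 * z)%g].

(** [right_code b y] says that [a b * y] may be used to encode [y]. The index
    [b] carries a label [xi] in [N]. The bound of [head y] by [b] makes decoding
    unique. The bound of [tail y] by the label and the condition on the support
    keep the encoded elements sparse in every left coset of [K]. *)
Definition right_code b y := exists xi w, [/\ N xi, W w, b = p (xi, w),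
  M b (head y) /\ M xi (tail y) & supp lt M a (lcoset (a b * y)) b].

Definition left_code c x := N c /\ M c (tail x).

Let X : set G := [set z | exists b y, right_code b y /\ z = (a b * y)%g].

(** Multiplying by [a b] stays in the right coset of [H], so only the heads
    matter. If [b] is the larger index, then [a b] is fresh over the heads and
    over the other multiplier. *)
Lemma right_decode b y b' y' : right_code b y -> right_code b' y' ->
  (a b * y = a b' * y')%g -> y = y'.
Proof.
move=> [xi [w [Nxi Ww -> [My _] _]]] [xi' [w' [Nxi' Ww' -> [My' _] _]]].
set c := p (xi, w) in My *; set c' := p (xi', w') in My' * => e.
have Wc : W c by exact: pW.
have Wc' : W c' by exact: pW.
have shift d z : W d -> rH (a d * z)%g = rH z.
  by move=> Wd; apply: rH_eq; rewrite mulgK; exact: H_mem.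
have rE : rH y = rH y' by rewrite -(shift c) // e shift.
have {}e : (a c * head y = a c' * head y')%g.
  by rewrite /head !mulgA e rE.
have neq d d' z z' : lt d d' -> M d z -> M d' z' -> (a d * z <> a d' * z')%g.
  move=> dd Mz Mz' e'; apply: (tower_fresh Ma (w := d')).
  rewrite -[a d'](mulgK z') -e'; have sM := tower_subgroup Ma d'.
  apply: (subgroupM sM); last exact: (subgroupV sM).
  by apply: (subgroupM sM); [exact: (tower_mem Ma)|exact: (tower_mono Ma dd)].
have cc : c = c'.
  have [_ _ tot] := lt_wo; case: (tot c c') => // h.
    by case: (neq _ _ _ _ h My My').
  by case: (neq _ _ _ _ h My' My).
move: e; rewrite cc => /mulgI; rewrite /head rE; exact: mulIg.
Qed.

Lemma left_decode c x c' x' : left_code c x -> left_code c' x' ->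
  (x * a c = x' * a c')%g -> x = x'.
Proof.
move=> [Nc Mx] [Nc' Mx'] e.
have shift d z : N d -> rK (z * a d)%g = rK z.
  by move=> Nd; apply/esym/rK_eq; rewrite mulKg; exact: K_mem.
have rE : rK x = rK x' by rewrite -(shift c) // e shift.
have {}e : (tail x * a c = tail x' * a c')%g.
  by rewrite /tail -!mulgA e rE.
have neq d d' z z' : lt d d' -> M d z -> M d' z' -> (z * a d <> z' * a d')%g.
  move=> dd Mz Mz' e'; apply: (tower_fresh Ma (w := d')).
  rewrite -[a d'](mulKg z') -e'; have sM := tower_subgroup Ma d'.
  apply: (subgroupM sM); first exact: (subgroupV sM).
  by apply: (subgroupM sM); [exact: (tower_mono Ma dd)|exact: (tower_mem Ma)].
have cc : c = c'.
  have [_ _ tot] := lt_wo; case: (tot c c') => // h.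
    by case: (neq _ _ _ _ h Mx Mx').
  by case: (neq _ _ _ _ h Mx' Mx).
move: e; rewrite cc => /mulIg; rewrite /tail rE; exact: mulgI.
Qed.

Lemma lcoset_eq x z : lcoset x z -> lcoset z = lcoset x.
Proof.
move=> xz; apply/seteqP; split=> t; rewrite /lcoset /= => h.
  by rewrite -(mulgK z x^-1)%g -mulgA; exact: subgroupM.
have -> : (z^-1 * t = (x^-1 * z)^-1 * (x^-1 * t))%g.
  by rewrite invgM invgK -mulgA mulVKg.
by apply: subgroupM => //; exact: subgroupV.
Qed.

(** An encoded element of a left coset has its index in the support of that
    coset, which is finite. For a fixed index, the encoded element is determined
    by the tail of what it encodes, and this tail lies in [M xi], of size at
    most [L]. *)
Lemma X_lcoset_card x : X `&` lcoset x #<= L.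
Proof.
pose piece b := [set z | lcoset x z /\
  exists xi w y, [/\ N xi, W w, b = p (xi, w), M xi (tail y) & z = (a b * y)%g]].
apply: (@card_le_trans _ _ _ (\bigcup_(b in supp lt M a (lcoset x)) piece b)).
  apply: subset_card_le => z [[b [y [[xi [w [Nxi Ww bE [My My'] sb]]] zE]]] xz].
  exists b; first by rewrite -(lcoset_eq xz) zE.
  by split=> //; exists xi, w, y.
apply: infinite_bigcup_le => //.
  apply: finite_le_infinite => //; apply: supp_finite Ma _ _ => //.
  by exists x; rewrite /lcoset /= mulVg; exact: subgroup1.
move=> b _.
have [[xi [w [Nxi Ww bE]]]|nb] := pselect (exists xi w, [/\ N xi, W w & b = p (xi, w)]);
  last first.
  suff -> : piece b = set0 by exact: card_ge0.
  apply/eqP/negPn/negP => /set0P[z [_ [xi [w [y [? ? ? _ _]]]]]].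
  by apply: nb; exists xi, w.
have MxiL : M xi #<= L by exact: (tower_card Ma).
apply: card_le_trans MxiL.
apply: (@card_le_rel _ _ (fun z h => exists2 y, z = (a b * y)%g & h = tail y)).
  move=> z [_ [xi' [w' [y [Nxi' Ww' bE' My zE]]]]]; exists (tail y); last by exists y.
  by have [<-] := p_inj Nxi' Ww' Nxi Ww (etrans (esym bE') bE).
move=> z z' h [xz _] [xz' _] _ [y zE ->] [y' zE' tE].
have rE : rK y = rK y'.
  apply: rK_eq; have : lcoset z z' by rewrite (lcoset_eq xz).
  by rewrite /lcoset /= zE zE' invgM -mulgA mulKg.
by rewrite zE zE'; congr (_ * _)%g; move: tE; rewrite /tail rE => /mulgI.
Qed.

(** By [supp_shift], the index [b] can only fail to enter the support if it was
    there already or if [a b * c] lies in [M b * c'] for two points of the left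
    coset of [y], that is, if some conjugate of an element [h] of [K] lies in
    [(a b)^-1 * M b]. Each [h] is responsible for one [b] only. *)
Lemma unsupported_card y :
  [set b | ~ supp lt M a (lcoset (a b * y)) b] #<= N.
Proof.
pose E := [set b | exists2 h, K h & M b (a b * (y * h * y^-1))%g].
apply: (@card_le_trans _ _ _ (supp lt M a (lcoset y) `|` E)).
  apply: subset_card_le => b nb; apply: contrapT => nE; apply: nb.
  have -> : lcoset (a b * y)%g = [set (a b * c)%g | c in lcoset y].
    apply/seteqP; split=> z; rewrite /lcoset /=.
      move=> Kz; exists ((a b)^-1 * z)%g; last by rewrite mulVKg.
      by move: Kz; rewrite invgM mulgA.
    by move=> [c Kc <-]; rewrite invgM -mulgA mulKg.
  apply: supp_shift => //.
  - by exists y; rewrite /lcoset /= mulVg; exact: subgroup1.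
  - move=> c c' yc yc' Mc; apply: nE; right; exists ((y^-1 * c) / (y^-1 * c'))%g.
      by have [_] := K_subgroup; apply.
    by rewrite invgM invgK !mulgA !mulgK.
  - by move=> sb; apply: nE; left.
apply: infinite_setU_le => //.
  apply: finite_le_infinite => //; apply: supp_finite Ma _ _ => //.
  by exists y; rewrite /lcoset /= mulVg; exact: subgroup1.
apply: card_le_trans K_card.
apply: (@card_le_rel _ _ (fun b h => M b (a b * (y * h * y^-1))%g)).
  by move=> b [h Kh Mb]; exists h.
have neq b b' g : lt b b' -> M b (a b * g)%g -> M b' (a b' * g)%g -> False.
  move=> bb Mb Mb'; apply: (tower_fresh Ma (w := b')).
  have sM := tower_subgroup Ma b'.
  rewrite -[a b'](mulgK g); have [_ h] := sM; apply: h => //.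
  rewrite -[g](mulKg (a b)); apply: (subgroupM sM).
    by apply: (subgroupV sM); exact: (tower_mem Ma).
  exact: (tower_mono Ma bb).
move=> b b' h _ _ _ Mb Mb'; have [_ _ tot] := lt_wo.
case: (tot b b') => // bb; first by case: (neq _ _ _ bb Mb Mb').
by case: (neq _ _ _ bb Mb' Mb).
Qed.

(** Each value of [f] appears at some stage, and these stages are bounded because
    a successor cardinal is regular. *)
Let common_level {V} (C : set V) (F : set G) (f : G -> G) :
    infinite_set C -> ~ ([set: G] #<= C) -> F #<= C ->
    (forall x, (\bigcup_(w in below lt C) M w) (f x)) ->
  exists2 c0, below lt C c0 & forall c, ~ lt c c0 -> forall x, F x -> M c (f x).
Proof.
move=> C_inf C_small FC fB.
have /choice[l lP] x : exists c, below lt C c /\ M c (f x).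
  by have [c] := fB x; exists c.
have [||c0 Bc0 c0P] := below_bounded lt_wo C_inf C_small (S := l @` F).
- exact: card_le_trans (card_image_le _ _) FC.
- by move=> _ [x _ <-]; have [] := lP x.
exists c0 => // c cc0 x Fx; have [_ Mx] := lP x.
have lc : lt (l x) c0 by apply: c0P; exists x.
have [_ tr tot] := lt_wo.
apply: (tower_mono Ma (v := l x)) => //.
by case: (tot c c0) => [//|->//|]; exact: tr lc.
Qed.

(** Each [x] spoils at most [L] of the multipliers in [N]: those that send it
    into the sparse set [X]. *)
Lemma left_capture (F : set G) : F #<= L ->
  exists2 c, forall x, F x -> left_code c x & forall x, F x -> ~ X (x * a c)%g.
Proof.
move=> FL; have [c0 Nc0 c0P] := common_level (f := tail) L_inf L_small FL rK_mem.
apply: contrapT => nex; apply: (below_not_le lt_wo L_small).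
pose bad x := [set c | N c /\ X (x * a c)%g].
apply: (@card_le_trans _ _ _ (seg lt c0 `|` \bigcup_(x in F) bad x)).
  apply: subset_card_le => c Nc; apply: contrapT => nc; apply: nex.
  have ncc0 : ~ lt c c0 by move=> h; apply: nc; left.
  exists c => x Fx; first by split=> //; exact: c0P.
  by move=> Xx; apply: nc; right; exists x.
apply: infinite_setU_le => //; apply: infinite_bigcup_le => // x _.
apply: card_le_trans (X_lcoset_card x).
apply: (@card_le_fun _ _ (fun c => x * a c)%g).
  by move=> c [Nc Xc]; split=> //; rewrite /lcoset /= mulKg; exact: K_mem.
by move=> c c' _ _ /mulgI; exact: tower_inj Ma _ _.
Qed.

(** Fix a label [xi] that bounds all tails. The indices with this label are as
    many as the elements of [W], while at most [N] of them are spoiled. *)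
Lemma right_capture (F : set G) : F #<= L ->
  exists b, forall y, F y -> right_code b y.
Proof.
move=> FL.
have FN : F #<= N by apply: card_le_trans FL (below_ge lt_wo _).
have [xi Nxi xiP] := common_level (f := tail) L_inf L_small FL rK_mem.
have [b0 Wb0 b0P] := common_level (f := head) N_inf N_small FN rH_mem.
apply: contrapT => nex; apply: (below_not_le lt_wo N_small).
pose bad y := [set b | ~ supp lt M a (lcoset (a b * y)) b].
have : seg lt b0 `|` \bigcup_(y in F) bad y #<= N.
  apply: infinite_setU_le => //; apply: infinite_bigcup_le => // y _.
  exact: unsupported_card.
apply: card_le_trans; apply: (@card_le_fun _ _ (fun w => p (xi, w))).
  move=> w Ww; apply: contrapT => nb; apply: nex; exists (p (xi, w)) => y Fy.
  exists xi, w; split=> //.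
    split; last by apply: xiP => //; exact: (wo_irr lt_wo).
    by apply: b0P => // h; apply: nb; left.
  by apply: contrapT => ns; apply: nb; right; exists y.
by move=> w w' Ww Ww' /(p_inj Nxi Ww Nxi Ww')[].
Qed.

(** An encoded element takes the colour of what it encodes. For left encoding
    the one-sided colouring is reflected by inversion. If [u] works for the
    one-sided colouring, then the product of [u] with a multiplier that encodes
    the whole translated set works for [Z]. *)
Lemma two_sided_family_aux (A : G -> set G) :
    (forall d d' z, A d z -> A d' z -> d = d') ->
    (forall d (F : set G), F #<= L -> exists u, forall y, F y -> A d (u * y)%g) ->
  exists Z : G -> set G,
    (forall d d' z, Z d z -> Z d' z -> d = d') /\
    forall d (F : set G), F #<= L ->
      (exists u, forall y, F y -> Z d (y * u)%g) /\
      (exists u, forall y, F y -> Z d (u * y)%g).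
Proof.
move=> Adisj Athick.
pose Z d := [set z |
  (exists b y, [/\ right_code b y, z = (a b * y)%g & A d y]) \/
  (~ X z /\ exists c x, [/\ left_code c x, z = (x * a c)%g & A d x^-1%g])].
exists Z; split.
  move=> d d' z [[b [y [cy zE Ay]]]|[nX [c [x [cx zE Ax]]]]]
    [[b' [y' [cy' zE' Ay']]]|[nX' [c' [x' [cx' zE' Ax']]]]].
  - apply: (Adisj _ _ y) => //.
    by rewrite (right_decode cy cy' (etrans (esym zE) zE')).
  - by case: nX'; exists b, y.
  - by case: nX; exists b', y'.
  - apply: (Adisj _ _ x^-1%g) => //.
    by rewrite (left_decode cx cx' (etrans (esym zE) zE')).
move=> d F FL; split.
  have [|u uA] := Athick d [set x^-1%g | x in F].
    exact: card_le_trans (card_image_le _ _) FL.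
  have [|c cl cX] := @left_capture [set (x / u)%g | x in F].
    exact: card_le_trans (card_image_le _ _) FL.
  exists (u^-1 * a c)%g => y Fy; rewrite mulgA.
  have Fyu : [set (x / u)%g | x in F] (y / u)%g by exists y.
  right; split; first exact: cX.
  exists c, (y / u)%g; split => //; first exact: cl.
  by rewrite invgF; apply: uA; exists y.
have [u uA] := Athick d F FL.
have [|b br] := @right_capture [set (u * y)%g | y in F].
  exact: card_le_trans (card_image_le _ _) FL.
exists (a b * u)%g => y Fy; left; exists b, (u * y)%g; split.
- by apply: br; exists y.
- by rewrite mulgA.
- exact: uA.
Qed.

End WithRepresentatives.

Theorem two_sided_family {q : G * G -> G} : (forall x y, q x = q y -> x = y) ->
  exists Z : G -> set G,
    (forall d d' z, Z d z -> Z d' z -> d = d') /\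
    forall d (F : set G), F #<= L ->
      (exists u, forall y, F y -> Z d (y * u)%g) /\
      (exists u, forall y, F y -> Z d (u * y)%g).
Proof.
move=> q_inj.
have [rK [rK_mem rK_eq]] := coset_representative K_subgroup.
have [r [r_mem r_eq]] := coset_representative H_subgroup.
have [A [Adisj Athick]] := one_sided_family lt_wo Ma L_inf N_inf (fun=> id)
  (below_not_le lt_wo L_small) q_inj.
have NW : N #<= W by exact: below_ge.
have [|p pW p_inj] := card_le_funP (infinite_setX_le W_inf NW (card_lexx W)).
  have [n Nn] := infinite_setN0 N_inf; have [w Ww] := infinite_setN0 W_inf.
  by exists (n, w).
pose rH (y : G) : G := (r y^-1)^-1%g.
have rH_mem y : H (y / rH y)%g.
  have := subgroupV H_subgroup (r_mem y^-1%g).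
  by rewrite invgM !invgK.
have rH_eq x y : H (x / y)%g -> rH x = rH y.
  by move=> Hxy; congr (_^-1)%g; apply: r_eq; rewrite invgK.
have pW' xi w : N xi -> W w -> W (p (xi, w)) by move=> Nxi Ww; exact: pW.
have p_inj' xi w xi' w' : N xi -> W w -> N xi' -> W w' ->
    p (xi, w) = p (xi', w') -> xi = xi' /\ w = w'.
  move=> Nx Ww Nx' Ww' e.
  by case: (p_inj (xi, w) (xi', w') (conj Nx Ww) (conj Nx' Ww') e).
exact: (two_sided_family_aux rK_mem rK_eq rH_mem rH_eq pW' p_inj' Adisj Athick).
Qed.

End Decoding.

(** * The bounded case *)

Section Bounded.
Context {G : groupType} {lt : G -> G -> Prop} {q : G * G -> G}.
Hypothesis lt_wo : strict_wo lt.
Hypothesis G_inf : infinite_set [set: G].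
Hypothesis seg_small : forall w, ~ ([set: G] #<= seg lt w).
Hypothesis bounded : forall S : set G, ~ ([set: G] #<= S) ->
  exists w, forall s, S s -> lt s w.
Hypothesis q_inj : forall x y, q x = q y -> x = y.

(** [S] stands for the translators chosen before stage [w]. *)
Let span w (S : set G) : set G :=
  seg lt w `|` [set x^-1%g | x in seg lt w] `|` S.

(** A word of length three is enough to express [a w] by the earlier data if two
    of the pieces in [bounded_family] meet. Words of bounded length are used
    instead of subgroups because [G] may be countable. *)
Lemma separated_translates : exists a : G -> G, forall w x y z,
  span w (a @` seg lt w) x -> span w (a @` seg lt w) y ->
  span w (a @` seg lt w) z -> a w <> (x * y * z)%g.
Proof.
have [wf _ _] := lt_wo.
pose Phi w S := setmul (setmul (span w S) (span w S)) (span w S).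
have small_setmul (A B : set G) : ~ ([set: G] #<= A) -> ~ ([set: G] #<= B) ->
    ~ ([set: G] #<= setmul A B).
  move=> hA hB h; apply: (small_setX G_inf hA hB).
  exact: card_le_trans h (card_image_le _ _).
have small_image (f : G -> G) w : ~ ([set: G] #<= f @` seg lt w).
  by move=> h; apply: (@seg_small w); exact: card_le_trans h (card_image_le _ _).
have [w S Sw|a aP] := greedy (Phi := Phi) wf.
  apply/existsNP => all.
  have span_small : ~ ([set: G] #<= span w S).
    apply: small_setU => //; first exact: small_setU.
    by move=> h; apply: (@seg_small w); exact: card_le_trans h Sw.
  have : ~ ([set: G] #<= Phi w S) by apply: (small_setmul) => //; exact: small_setmul.
  by apply; apply: subset_card_le => t _; exact: all.
exists a => w x y z Ex Ey Ez awE; apply: (aP w); rewrite awE.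
by exists ((x * y)%g, z) => //; split => //; exists (x, y).
Qed.

(** The pieces [a b * seg b] and [seg b * a b] are pairwise disjoint for
    different [b]. Since a set smaller than [G] is contained in a segment, a
    union of pieces over an unbounded set of indices is thick; the indices
    [q (d, w)] with [d] fixed are as many as the elements of [G], hence
    unbounded. *)
Theorem bounded_family : exists Z : G -> set G,
  (forall d d' z, Z d z -> Z d' z -> d = d') /\
  forall d (F : set G), ~ ([set: G] #<= F) ->
    (exists u, forall y, F y -> Z d (y * u)%g) /\
    (exists u, forall y, F y -> Z d (u * y)%g).
Proof.
have [a aP] := separated_translates; have [_ tr tot] := lt_wo.
pose piece b z := exists2 m, lt m b & z = (a b * m)%g \/ z = (m * a b)%g.
have sep b b' z : lt b' b -> piece b z -> piece b' z -> False.
  move=> bb [m mb zE] [m' mb' zE'].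
  have Sm : span b (a @` seg lt b) m by left; left.
  have SmV : span b (a @` seg lt b) m^-1%g by left; right; exists m.
  have Sm' : span b (a @` seg lt b) m' by left; left; exact: tr bb.
  have Sb' : span b (a @` seg lt b) (a b') by right; exists b'.
  case: zE => zE; case: zE' => zE'; rewrite zE in zE'.
  - by apply: (aP b _ _ _ Sb' Sm' SmV); rewrite -zE' mulgK.
  - by apply: (aP b _ _ _ Sm' Sb' SmV); rewrite -zE' mulgK.
  - by apply: (aP b _ _ _ SmV Sb' Sm'); rewrite -mulgA -zE' mulKg.
  - by apply: (aP b _ _ _ SmV Sm' Sb'); rewrite -mulgA -zE' mulKg.
have piece_eq b b' z : piece b z -> piece b' z -> b = b'.
  move=> bz bz'; case: (tot b b') => // h.
    by case: (sep _ _ _ h bz' bz).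
  by case: (sep _ _ _ h bz bz').
exists (fun d z => exists w, piece (q (d, w)) z); split.
  by move=> d d' z [w wz] [w' wz']; have /q_inj[] := piece_eq _ _ _ wz wz'.
move=> d F /bounded[w0 Fw0].
have [w w0w] : exists w, lt w0 (q (d, w)).
  apply: contrapT => nex.
  have le w : q (d, w) = w0 \/ lt (q (d, w)) w0.
    by case: (tot w0 (q (d, w))) => [h|->|]; [case: nex; exists w|left|right].
  have : ~ ([set: G] #<= seg lt w0 `|` [set w0]).
    apply: small_setU => // h; apply: G_inf.
    exact: card_le_finite h (finite_set1 _).
  apply; apply: (@card_le_fun _ _ (fun w => q (d, w))).
    by move=> w _; case: (le w) => ?; [right|left].
  by move=> w w' _ _ /q_inj[].
by split; exists (a (q (d, w))) => y Fy; exists w, y;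
  [exact: tr (Fw0 _ Fy) w0w|right|exact: tr (Fw0 _ Fy) w0w|left].
Qed.

End Bounded.

(** * From families to partitions *)

(** The uncoloured elements are added to the colour of the identity, which keeps
    it thick. The translator itself is put in the thick set by adding the
    identity to [F]. *)
Lemma partition_of_family (G : groupType) (U : Type) (L : set U) (Z : G -> set G) :
    infinite_set L ->
    (forall d d' z, Z d z -> Z d' z -> d = d') ->
    (forall d (F : set G), F #< L ->
      (exists u, forall y, F y -> Z d (y * u)%g) /\
      (exists u, forall y, F y -> Z d (u * y)%g)) ->
  exists P : set (set G),
    [/\ partition P id [set: G], P #= [set: G] & forall A, P A -> thick L A].
Proof.
move=> L_inf Zdisj Zthick.
pose Z' d : set G := fun z => Z d z \/ (d = 1%g /\ forall d', ~ Z d' z).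
have Z'disj d d' z : Z' d z -> Z' d' z -> d = d'.
  move=> [dz|[-> nz]] [dz'|[-> nz']] //.
  - exact: Zdisj dz dz'.
  - by case: (nz' d).
  - by case: (nz d').
have add1 (F : set G) : F #< L -> (F `|` [set 1%g]) #< L.
  move=> [FL LF]; have f1 : finite_set [set 1%g : G] by exact: finite_set1.
  split; first by apply: infinite_setU_le => //; exact: finite_le_infinite.
  by apply: small_setU => // h; apply: L_inf; exact: card_le_finite h f1.
have Z'thick d : thick L (Z' d).
  split=> F /add1 /(Zthick d)[[u uP] [v vP]].
    exists u; first by rewrite -[u]mul1g; left; apply: uP; right.
    by move=> _ [y Fy <-]; left; apply: uP; left.
  exists v; first by rewrite -[v]mulg1; left; apply: vP; right.
  by move=> _ [y Fy <-]; left; apply: vP; left.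
have Z'n0 d : Z' d !=set0.
  have [+ _] := Z'thick d; case/(_ set0); last by move=> u ? _; exists u.
  split; first exact: card_ge0.
  by move=> /card_le0P L0; apply: L_inf; rewrite L0; exact: finite_set0.
exists (range Z'); split.
- split.
  + apply/seteqP; split=> // z _.
    have [[d dz]|nd] := pselect (exists d, Z d z).
      by exists (Z' d); [exists d|left].
    exists (Z' 1%g); [by exists 1%g|right; split => // d dz].
    by apply: nd; exists d.
  + by move=> _ _ [d _ <-] [d' _ <-] [z [/= dz dz']]; rewrite (Z'disj _ _ _ dz dz').
  + by move=> _ [d _ <-].
- apply: inj_card_eq => d d' _ _ dd; have [z dz] := Z'n0 d.
  by apply: (Z'disj _ _ z) => //; rewrite -dd.
- by move=> _ [d _ <-].
Qed.

Theorem theorem8p1 (G : groupType) (U : Type) (L : set U)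
    (infG : infinite_set [set: G])
    (infL : infinite_set L)
    (leLG : L #<= [set: G])
    (hL : (L #= [set: G] /\ regular_cardinal [set: G]) \/ L #< [set: G]) :
  exists P : set (set G),
    [/\ partition P id [set: G],
        P #= [set: G] &
        forall A, P A -> thick L A].
Proof.
have [lt wo seg_small] := initial_wo_exists G.
have [wf tr tot] := wo.
have [|q _ q_inj'] := card_le_funP (infinite_square_setT infG).
  by exists (1%g, 1%g).
have {q_inj'} q_inj x y : q x = q y -> x = y by exact: q_inj'.
suff [Z [Zdisj Zthick]] : exists Z : G -> set G,
    (forall d d' z, Z d z -> Z d' z -> d = d') /\
    forall d (F : set G), F #< L ->
      (exists u, forall y, F y -> Z d (y * u)%g) /\
      (exists u, forall y, F y -> Z d (u * y)%g).
  exact: partition_of_family Zdisj Zthick.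
have weaken (F : set G) : F #< L -> ~ ([set: G] #<= F).
  by move=> [_ LF] GF; apply: LF; exact: card_le_trans leLG GF.
have from_bounded : (forall S : set G, ~ ([set: G] #<= S) ->
    exists w, forall s, S s -> lt s w) ->
    exists Z : G -> set G, (forall d d' z, Z d z -> Z d' z -> d = d') /\
    forall d (F : set G), F #< L ->
      (exists u, forall y, F y -> Z d (y * u)%g) /\
      (exists u, forall y, F y -> Z d (u * y)%g).
  move=> bounded.
  have [Z [Zd Zt]] := bounded_family wo infG seg_small bounded q_inj.
  by exists Z; split=> // d F /weaken; exact: Zt.
have cofinal (S : set G) : (forall w, ~ forall s, S s -> lt s w) ->
    [set: G] `<=` \bigcup_(s in S) (seg lt s `|` [set s]).
  move=> unb w _; apply: contrapT => nw; apply: (unb w) => s Ss.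
  case: (tot s w) => // [sw|ws]; case: nw; exists s => //; first by right.
  by left.
case: hL => [[_ [_ reg]]|[_ GL]].
  apply: from_bounded => S GS; apply: contrapT => /forallNP unb.
  have [||_] := reg S (fun s => seg lt s `|` [set s]); last 1 first.
  - by apply; apply: subset_card_le; exact: cofinal.
  - by split=> //; exact: card_leT.
  - move=> s _; split; first exact: card_leT.
    apply: small_setU => // h; apply: infG.
    exact: card_le_finite h (finite_set1 _).
have N_inf : infinite_set (below lt L) by exact: below_infinite.
(* If the successor of [L] is as large as [G], then [G] has only segments of
   size at most [L], and the bounded case applies. *)
have [GN|GN] := pselect ([set: G] #<= below lt L); last first.
  have [M [a Ma]] := tower_exists wo infL leLG GL seg_small.
  have [Z [Zd Zt]] := two_sided_family wo Ma infL GL GN q_inj.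
  by exists Z; split=> // d F [FL _]; exact: Zt.
have segL w : seg lt w #<= L.
  have [//|nw] := pselect (seg lt w #<= L).
  exfalso; apply: (seg_small w); apply: card_le_trans GN _.
  apply: subset_card_le => v vL; case: (tot v w) => // [vw|wv].
    by case: nw; rewrite -vw.
  case: nw; apply: card_le_trans (subset_card_le _) vL => u; exact: (tr _ _ _ ^~ wv).
apply: from_bounded => S GS; apply: contrapT => /forallNP unb.
have pieceL s : seg lt s `|` [set s] #<= L.
  apply: infinite_setU_le => //.
  by apply: finite_le_infinite => //; exact: finite_set1.
have GU := subset_card_le (cofinal S unb).
have [SL|LS] := card_le_total S L.
  by apply: GL; apply: card_le_trans GU _; exact: infinite_bigcup_le.
apply: GS; apply: card_le_trans GU _; apply: infinite_bigcup_le => //.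
  exact: infinite_le infL.
by move=> s _; exact: card_le_trans LS.
Qed.
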